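(* Let $R$ be a ring, $M$ an $R$-module, $S$ a multiplicatively closed subset of $R$ and $I$ an ideal of $R$ with $I\cap S=\emptyset$. The following statements are equivalent: (1) $I$ is an $S$-$1$-absorbing primary ideal of $R$. (2) $I(+)M$ is an $S(+)0$-$1$-absorbing primary ideal of $R(+)M$. (3) $I(+)M$ is an $S(+)M$-$1$-absorbing primary ideal of $R(+)M$.
   Context: All rings are commutative with non-zero identity and all modules are unital. The idealization $R(+)M$ is the commutative ring $\{(r,m)\mid r\in R,\ m\in M\}$ with componentwise addition and multiplication $(r_1,m_1)(r_2,m_2)=(r_1r_2,\,r_1m_2+r_2m_1)$. For subsets $X\subseteq R$ and $Y\subseteq M$, $X(+)Y=\{(x,y)\mid x\in X,\ y\in Y\}$; in particular $S(+)0=\{(s,0)\mid s\in S\}$ and $S(+)M=\{(s,m)\mid s\in S, m\in M\}$ are multiplicatively closed subsets of $R(+)M$. For a multiplicatively closed subset $S$ of a ring $R$, a proper ideal $I$ of $R$ with $I\cap S=\emptyset$ is called $S$-$1$-absorbing primary if there exists a fixed $s\in S$ such that for all non-unit $a,b,c\in R$, if $abc\in I$, then $sab\in I$ or $sc\in\sqrt{I}$. *)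

(* Defs.v *)
From HB Require Import structures.
From mathcomp Require Import all_boot all_order all_algebra.
From mathcomp Require Import classical_sets.

Set Implicit Arguments.
Unset Strict Implicit.
Unset Printing Implicit Defensive.

Import GRing.Theory.

Local Open Scope ring_scope.
Local Open Scope classical_set_scope.

(* An R-submodule of R, possibly R itself: MathComp's idealr_closed would
   force properness. *)
Definition is_ideal (R : comNzRingType) (I : set R) : Prop :=
  GRing.submod_closed ([in I] : {pred R^o}).

Definition is_proper_ideal (R : comNzRingType) (I : set R) : Prop :=
  is_ideal I /\ I <> setT.

(* Only closure under binary products; neither 1 \in S nor S nonempty is
   required. *)
Definition is_mult_closed (R : comNzRingType) (S : set R) : Prop :=
  GRing.mulr_2closed [in S].

(* GRing.unit needs a unitRingType, i.e. a boolean test for invertibility,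
   which an arbitrary commutative ring does not carry. *)
Definition is_unit (R : comNzRingType) (a : R) : Prop := exists b, a * b = 1.

Definition radical (R : comNzRingType) (I : set R) : set R :=
  [set x | exists2 n, (0 < n)%N & I (x ^+ n)].

Definition S_1_absorbing_primary (R : comNzRingType) (S I : set R) : Prop :=
  [/\ is_proper_ideal I,
      I `&` S = set0 &
      exists2 s, S s &
        forall a b c : R, ~ is_unit a -> ~ is_unit b -> ~ is_unit c ->
          I (a * b * c) -> I (s * a * b) \/ radical I (s * c)].

(* An alias of R * M, so that the multiplication below does not compete with
   the componentwise one on products; the additive structure is that of
   R * M. *)
Definition idealization (R : comNzRingType) (M : lmodType R) : Type :=
  (R * M)%type.

HB.instance Definition _ (R : comNzRingType) (M : lmodType R) :=
  GRing.Zmodule.copy (idealization M) (R * M)%type.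

Definition idealization_one (R : comNzRingType) (M : lmodType R) :
  idealization M := (1, 0).

Definition idealization_mul (R : comNzRingType) (M : lmodType R)
  (x y : idealization M) : idealization M :=
  (x.1 * y.1, x.1 *: y.2 + y.1 *: x.2).

Fact idealization_mulA (R : comNzRingType) (M : lmodType R) :
  associative (@idealization_mul R M).
Proof.
move=> [a m] [b n] [c p]; congr pair; rewrite /= ?mulrA //.
by rewrite !scalerDr !scalerA addrA (mulrC c a) (mulrC c b).
Qed.

Fact idealization_mulC (R : comNzRingType) (M : lmodType R) :
  commutative (@idealization_mul R M).
Proof. by move=> [a m] [b n]; congr pair; rewrite /= 1?mulrC 1?addrC. Qed.

Fact idealization_mul1 (R : comNzRingType) (M : lmodType R) :
  left_id (@idealization_one R M) (@idealization_mul R M).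
Proof.
by move=> [a m]; rewrite /idealization_mul /= mul1r scale1r scaler0 addr0.
Qed.

Fact idealization_mulDl (R : comNzRingType) (M : lmodType R) :
  left_distributive (@idealization_mul R M) +%R.
Proof.
move=> [a m] [b n] [c p]; congr pair; rewrite /= ?mulrDl //.
by rewrite scalerDl scalerDr addrACA.
Qed.

Fact idealization_one_neq0 (R : comNzRingType) (M : lmodType R) :
  @idealization_one R M != 0.
Proof. by apply/eqP => -[/eqP]; rewrite oner_eq0. Qed.

HB.instance Definition _ (R : comNzRingType) (M : lmodType R) :=
  GRing.Zmodule_isComNzRing.Build (idealization M)
    (@idealization_mulA R M) (@idealization_mulC R M)
    (@idealization_mul1 R M) (@idealization_mulDl R M)
    (@idealization_one_neq0 R M).

Definition idealization_set (R : comNzRingType) (M : lmodType R)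
  (X : set R) (Y : set M) : set (idealization M) := X `*` Y.

Notation "X (+) Y" := (idealization_set X Y) : classical_set_scope.

Fact is_mult_closed_idealization0 (R : comNzRingType) (M : lmodType R)
  (S : set R) : is_mult_closed S -> is_mult_closed (S (+) [set (0 : M)]).
Proof.
move=> mS [a m] [b n] /set_mem[/= Sa ->] /set_mem[/= Sb ->].
apply/mem_set; split => /=; last by rewrite !scaler0 addr0.
by apply/set_mem/mS; apply/mem_set.
Qed.

Fact is_mult_closed_idealizationT (R : comNzRingType) (M : lmodType R)
  (S : set R) : is_mult_closed S -> is_mult_closed (S (+) [set: M]).
Proof.
move=> mS [a m] [b n] /set_mem[/= Sa _] /set_mem[/= Sb _].
apply/mem_set; split => //=.
by apply/set_mem/mS; apply/mem_set.
Qed.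

(* Main.v *)
Require Import Defs.
From HB Require Import structures.
From mathcomp Require Import all_boot all_order all_algebra.
From mathcomp Require Import classical_sets.

(** The three statements are equivalent because [I (+) M] is the inverse image
    of [I] under the projection [(r, m) |-> r], a surjective ring morphism that
    maps both [S (+) 0] and [S (+) M] onto [S]. The kernel [0 (+) M] of this
    projection squares to zero, so the projection also reflects units. These
    properties are all that matters: along any surjective ring morphism [f]
    that reflects units, every ingredient of the definition
    (properness, disjointness, non-units, membership and membership in the
    radical) transfers between [I] and [f @^-1` I]. Hence [I] is
    [f(T)]-1-absorbing primary if and only if [f @^-1` I] is
    [T]-1-absorbing primary, whichever set [T] is; [absorbing_preimage] states
    this. The choices [T = S (+) 0] and [T = S (+) M] then give (1) <-> (2) and
    (1) <-> (3). *)

Import GRing.Theory.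

Local Open Scope ring_scope.
Local Open Scope classical_set_scope.

Section Preimage.

Variables (A B : comNzRingType) (f : {rmorphism A -> B}).

Lemma ideal_preimage (I : set B) : is_ideal I -> is_ideal (f @^-1` I).
Proof.
move=> [I0 Ilin]; split.
  by apply/mem_set; rewrite /preimage /= rmorph0; apply/set_mem.
move=> a u v /set_mem Iu /set_mem Iv; apply/mem_set.
rewrite /preimage /= rmorphD rmorphM.
by apply/set_mem/Ilin; apply/mem_set.
Qed.

Lemma radical_preimage (I : set B) (x : A) :
  radical (f @^-1` I) x <-> radical I (f x).
Proof.
by split=> -[n n0 In]; exists n; move: In; rewrite /preimage /= ?rmorphXn.
Qed.

Lemma is_unit_rmorph (x : A) : is_unit x -> is_unit (f x).
Proof. by case=> y xy1; exists (f y); rewrite -rmorphM xy1 rmorph1. Qed.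

Lemma preimage_disjoint (T : set A) (I : set B) :
  (f @^-1` I) `&` T = set0 <-> I `&` (f @` T) = set0.
Proof.
split=> IT0; apply/seteqP; split=> // x [].
  by move=> + [y Ty fyx]; rewrite -fyx => Ify; suff: set0 y by []; rewrite -IT0.
by move=> Ifx Tx; suff: set0 (f x) by []; rewrite -IT0; split=> //; exists x.
Qed.

Hypothesis f_surj : forall y, exists x, f x = y.
Hypothesis f_unit : forall x, is_unit (f x) -> is_unit x.

Lemma proper_preimage (I : set B) : f @^-1` I = setT <-> I = setT.
Proof.
split=> [fIT|->//]; apply/seteqP; split=> // y _.
by have [x <-] := f_surj y; suff: (f @^-1` I) x by []; rewrite fIT.
Qed.

(** A triple of non-units of [A] is pushed forward by [f], and its images are
    non-units because [f] reflects units; a triple of non-units of [B] is lifted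
    by surjectivity, and its lifts are non-units because any ring morphism
    preserves units. Since the multiplicative set of [B] is [f @` T], an element
    [t] of [T] serves as the fixed witness for [f @^-1` I] exactly when [f t]
    serves for [I]. *)
Lemma absorbing_preimage (T : set A) (I : set B) : is_ideal I ->
  S_1_absorbing_primary (f @` T) I <-> S_1_absorbing_primary T (f @^-1` I).
Proof.
move=> idI; split=> -[[_ Iproper] /preimage_disjoint disjIT].
  case=> _ [t Tt <-] absI; split=> //.
    by split; [exact: ideal_preimage | move=> /proper_preimage].
  exists t => // a b c na nb nc; rewrite /preimage /= !rmorphM => Iabc.
  have nf x : ~ is_unit x -> ~ is_unit (f x) by move=> nx /f_unit.
  have [Itab|Itc] := absI _ _ _ (nf _ na) (nf _ nb) (nf _ nc) Iabc.
    by left.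
  by right; apply/radical_preimage; rewrite rmorphM.
case=> t Tt absI; split=> //.
  by split=> // /proper_preimage.
exists (f t); first by exists t.
move=> fa fb fc.
have [[[a <-] [b <-]] [c <-]] := (f_surj fa, f_surj fb, f_surj fc).
have nf x : ~ is_unit (f x) -> ~ is_unit x by move=> nx /is_unit_rmorph.
move=> /nf na /nf nb /nf nc Iabc.
have [||Itc] := absI a b c na nb nc; rewrite /preimage /= ?rmorphM //.
  by left.
by right; rewrite -rmorphM; apply/radical_preimage.
Qed.

End Preimage.

Section Idealization.

Variables (R : comNzRingType) (M : lmodType R).

Definition idealization_fst (x : idealization M) : R := x.1.

Fact idealization_fst_is_zmod_morphism : zmod_morphism idealization_fst.
Proof. by []. Qed.

Fact idealization_fst_is_monoid_morphism : monoid_morphism idealization_fst.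
Proof. by []. Qed.

HB.instance Definition _ := GRing.isZmodMorphism.Build (idealization M) R
  idealization_fst idealization_fst_is_zmod_morphism.

HB.instance Definition _ := GRing.isMonoidMorphism.Build (idealization M) R
  idealization_fst idealization_fst_is_monoid_morphism.

Lemma idealization_fst_surj (r : R) : exists x, idealization_fst x = r.
Proof. by exists (r, 0). Qed.

(** If [b] inverts [r] then [(r, m) = (r, 0) (1, b m)], where the second factor
    is [1] plus an element of square zero, with inverse [(1, - b m)]. *)
Lemma idealization_fst_unit (x : idealization M) :
  is_unit (idealization_fst x) -> is_unit x.
Proof.
case: x => r m [b rb1]; exists (b, - (b * b) *: m); congr pair => //=.
by rewrite scalerA mulrN mulrA rb1 mul1r scaleNr addNr.
Qed.

Lemma idealization_setT (I : set R) :
  I (+) [set: M] = idealization_fst @^-1` I.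
Proof. by apply/seteqP; split=> [x []|x Ix]. Qed.

Lemma idealization_fst_image (S : set R) (Y : set M) : Y !=set0 ->
  idealization_fst @` (S (+) Y) = S.
Proof.
case=> m Ym; apply/seteqP; split=> [_ [x [Sx _] <-] // | s Ss].
by exists (s, m).
Qed.

Lemma absorbing_idealization (S I : set R) (Y : set M) :
  is_ideal I -> Y !=set0 ->
  S_1_absorbing_primary S I <->
  S_1_absorbing_primary (S (+) Y) (I (+) [set: M]).
Proof.
move=> idI Y0; rewrite idealization_setT -{1}(idealization_fst_image S Y Y0).
exact: (absorbing_preimage _ _ _ idealization_fst_surj idealization_fst_unit).
Qed.

End Idealization.

Theorem proposition9 (R : comNzRingType) (M : lmodType R) (S I : set R)
  (mult_closedS : is_mult_closed S) (idealI : is_ideal I)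
  (disjointIS : I `&` S = set0) :
  [<-> S_1_absorbing_primary S I;
       S_1_absorbing_primary (S (+) [set (0 : M)]) (I (+) [set: M]);
       S_1_absorbing_primary (S (+) [set: M]) (I (+) [set: M])].
Proof.
have iff0 := absorbing_idealization R M S I [set 0] idealI (ex_intro _ 0 erefl).
have iffT := absorbing_idealization R M S I [set: M] idealI (ex_intro _ 0 Logic.I).
by tfae=> [/iff0|/iff0/iffT|/iffT].
Qed.
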